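(* Let $U\in\mathrm{SpSt}(2n,2k)$ and $\Delta\in T_U\mathrm{SpSt}(2n,2k)$. Define $$\bar A:=J_{2k}U^T\Delta(U^TU)^{-1}J_{2k}+(U^TU)^{-1}\Delta^TU-(U^TU)^{-1}\Delta^TJ_{2n}^TU(U^TU)^{-1}J_{2k},$$ $$\bar H:=(I_{2n}-UU^+)J_{2n}\Delta(U^TU)^{-1}J_{2k},\qquad \bar\Delta:=U\bar A+\bar H,$$ $$X:=\begin{bmatrix}(I_{2n}-\frac12UU^+)\bar\Delta&-U\end{bmatrix}\in\mathbb{R}^{2n\times4k},\qquad Y:=\begin{bmatrix}J_{2n}^TUJ_{2k}&\big(\bar\Delta^+(I_{2n}-\frac12UU^+)\big)^T\end{bmatrix}\in\mathbb{R}^{2n\times4k},$$ $$\hat X:=\begin{bmatrix}Y&-X\end{bmatrix}\in\mathbb{R}^{2n\times8k},\qquad\hat Y:=\begin{bmatrix}X&Y\end{bmatrix}\in\mathbb{R}^{2n\times8k}.$$ Then the Riemannian exponential of $\mathrm{SpSt}(2n,2k)$ with respect to $g^{\mathrm{SpSt}}$ satisfies $$\mathrm{Exp}^{\mathrm{SpSt},g}_U(\Delta)=\hat X\exp(\hat Y^T\hat X)\begin{bmatrix}0_{4k}\\ I_{4k}\end{bmatrix}\exp(Y^TX)\begin{bmatrix}0_{2k}\\ I_{2k}\end{bmatrix}.$$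
   Context: Let $k\le n$ be positive integers, $J_{2m}=\begin{bmatrix}0&I_m\\ -I_m&0\end{bmatrix}$, and for a real $2a\times 2b$ matrix $A$ put $A^+:=J_{2b}^TA^TJ_{2a}$ (symplectic inverse). $\mathfrak{sp}(2k,\mathbb{R})=\{\Omega\in\mathbb{R}^{2k\times2k}:\Omega^+=-\Omega\}$. $\mathrm{SpSt}(2n,2k)=\{U\in\mathbb{R}^{2n\times2k}:U^+U=I_{2k}\}$, with tangent spaces $T_U\mathrm{SpSt}(2n,2k)=\{\Delta\in\mathbb{R}^{2n\times2k}: U^+\Delta\in\mathfrak{sp}(2k,\mathbb{R})\}$, equipped with the Riemannian metric $$g^{\mathrm{SpSt}}_U(\Delta_1,\Delta_2)=\mathrm{tr}\left(\Delta_1^T\left(I_{2n}-\tfrac12J_{2n}^TU(U^TU)^{-1}U^TJ_{2n}\right)\Delta_2(U^TU)^{-1}\right).$$ Its exponential map is $\mathrm{Exp}^{\mathrm{SpSt},g}_U(\Delta)=\exp\big(\bar\Omega(\Delta)-\bar\Omega(\Delta)^T\big)\exp\big(\bar\Omega(\Delta)^T\big)U$ with $\bar\Omega(\Delta)=\Delta(U^TU)^{-1}U^T+J_{2n}U(U^TU)^{-1}\Delta^T\left(I_{2n}-J_{2n}^TU(U^TU)^{-1}U^TJ_{2n}\right)J_{2n}$; here $\exp$ is the matrix exponential. $0_m$ and $I_m$ denote the $m\times m$ zero and identity matrices. *)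

(* Defs.v *)
From mathcomp Require Import all_boot all_order all_algebra.
From mathcomp Require Import all_classical all_reals all_analysis.

Set Implicit Arguments.
Unset Strict Implicit.
Unset Printing Implicit Defensive.

Import Order.TTheory GRing.Theory Num.Theory.
Import numFieldNormedType.Exports.

Local Open Scope classical_set_scope.
Local Open Scope ring_scope.

(* Even dimensions 2m are written m + m, so that 2 x 2 block matrices typecheck
   without casts. *)

(* Matrix exponential: the sum of the series A^i / i!, in the (entrywise)
   topology of matrices. *)
Definition expmx (R : realType) (n : nat) (A : 'M[R]_n) : 'M[R]_n :=
  limn (series (fun i : nat => (i`!%:R : R)^-1 *: A ^+ i)).

Definition Jmx (R : realType) (m : nat) : 'M[R]_(m + m) :=
  block_mx 0 1%:M (- 1%:M) 0.

Definition sympl_inv (R : realType) (a b : nat) (A : 'M[R]_(a + a, b + b)) :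
    'M[R]_(b + b, a + a) :=
  (Jmx R b)^T *m A^T *m Jmx R a.

Definition sp (R : realType) (k : nat) : set 'M[R]_(k + k) :=
  [set Omega | sympl_inv Omega = - Omega].

Definition SpSt (R : realType) (n k : nat) : set 'M[R]_(n + n, k + k) :=
  [set U | sympl_inv U *m U = 1%:M].

Definition tangent_SpSt (R : realType) (n k : nat) (U : 'M[R]_(n + n, k + k)) :
    set 'M[R]_(n + n, k + k) :=
  [set Delta | sp (sympl_inv U *m Delta)].

Definition Omega_bar (R : realType) (n k : nat)
    (U Delta : 'M[R]_(n + n, k + k)) : 'M[R]_(n + n) :=
  let G := invmx (U^T *m U) in
  let J := Jmx R n in
  Delta *m G *m U^T
  + J *m U *m G *m Delta^T *m (1%:M - J^T *m U *m G *m U^T *m J) *m J.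

(* Closed form of the Riemannian exponential of SpSt at U for the metric
     g_U(D1, D2) = tr (D1^T (I - 1/2 J^T U (U^T U)^-1 U^T J) D2 (U^T U)^-1). *)
Definition Exp_SpSt (R : realType) (n k : nat)
    (U Delta : 'M[R]_(n + n, k + k)) : 'M[R]_(n + n, k + k) :=
  expmx (Omega_bar U Delta - (Omega_bar U Delta)^T)
  *m expmx (Omega_bar U Delta)^T *m U.

(* Main.v *)
Require Import Defs.
From mathcomp Require Import all_boot all_order all_algebra.
From mathcomp Require Import all_classical all_reals all_analysis.
From mathcomp Require Import ring.

Import Order.TTheory GRing.Theory Num.Theory.
Import numFieldNormedType.Exports.
Local Open Scope classical_set_scope.
Local Open Scope ring_scope.

(** The closed form of the exponential map is a product of two exponentials of
    (2n) x (2n) matrices.  It collapses to small exponentials because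
    Omega_bar^T has rank at most 4k, with an explicit factorization
    Omega_bar^T = X Y^T; then
      Omega_bar - Omega_bar^T = Y X^T - X Y^T = Xhat Yhat^T.
    Whenever A X = X B, every power and hence the exponential satisfies
    exp(A) X = X exp(B) ([expmx_intertwine]); applied to (X Y^T) X = X (Y^T X)
    this moves X across the exponential and shrinks it.  Since U is, up to sign,
    the last block of X, and X is, up to sign, the last block of Xhat, this can
    be done twice:
      exp(X Y^T) U = - X exp(Y^T X) [0; I],
      exp(Xhat Yhat^T) X = - Xhat exp(Yhat^T Xhat) [0; I].

    The factorization is where the symplectic geometry enters.  Write
    G = (U^T U)^-1, D = J Delta G J and S = G U^T D.  Unfolding the definition
    gives Omega_bar^T = D U^+ - U D^+ - U S U^+ ([Omega_bar_tr]).  Tangency of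
    Delta makes S Hamiltonian ([twisted_quadratic_sp]), which turns the given
    Abar into U^+ D - D^+ U - S, so that Deltabar = U Abar + (I - U U^+) D.  For
    P = I - U U^+ / 2 the products P Deltabar and Deltabar^+ P each keep one half
    of the U Abar U^+ contribution, and
    P Deltabar U^+ - U Deltabar^+ P = Omega_bar^T
    ([sp_lift_rank_factorization]); the left side is X Y^T. *)

(** * Convergence of matrix series and intertwining of exponentials *)

Lemma cvg_mxP (R : realType) (m n : nat) (u : nat -> 'M[R]_(m, n))
    (M : 'M[R]_(m, n)) :
  (u @ \oo --> M) <-> (forall i j, (fun p => u p i j) @ \oo --> M i j).
Proof.
split=> [uM i j|uM].
  exact: (cvg_comp _ _ uM (@coord_continuous _ _ _ i j M)).
move=> A [P PM PA]; apply: filterS PA _.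
have : \forall p \near \oo, forall ij : 'I_m * 'I_n, P ij.1 ij.2 (u p ij.1 ij.2).
  by apply: filter_forall => -[i j]; exact: uM (PM i j).
by apply: filterS => p Pp i j; exact: (Pp (i, j)).
Qed.

(** The sum of the absolute values of all entries dominates every row sum, so it
    bounds entries of products without any factor depending on the dimension. *)
Lemma normr_mx_exp_entry (R : realType) (n : nat) (A : 'M[R]_n) (p : nat) i j :
  `|(A ^+ p) i j| <= (\sum_i \sum_j `|A i j|) ^+ p.
Proof.
set c := \sum_i _.
have c_ge0 : 0 <= c by do 2 (apply: sumr_ge0 => ? _).
elim: p i j => [|p IHp] i j.
  rewrite !expr0 mxE; case: eqP => _; rewrite ?normr1 ?normr0 ?ler01 //.
rewrite exprS mxE (le_trans (ler_norm_sum _ _ _)) // exprS.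
rewrite (@le_trans _ _ ((\sum_l `|A i l|) * c ^+ p)) //.
  by rewrite mulr_suml ler_sum // => l _; rewrite normrM ler_wpM2l.
rewrite ler_wpM2r ?exprn_ge0 // /c [leRHS](bigD1 i) //= lerDl.
by do 2 (apply: sumr_ge0 => ? _).
Qed.

Lemma series_mxE (R : realType) (m n : nat) (u : nat -> 'M[R]_(m, n)) p i j :
  series u p i j = series (fun l => u l i j) p.
Proof. by rewrite !seriesEnat /= summxE. Qed.

(** Convergence has to be known before any algebra on [expmx], whose value is
    meaningless otherwise; each entry is dominated by the scalar exponential
    series at the sum of the absolute values of the entries. *)
Lemma is_cvg_expmx (R : realType) (n : nat) (A : 'M[R]_n) :
  cvgn (series (fun p : nat => (p`!%:R : R)^-1 *: A ^+ p)).
Proof.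
set c := \sum_i \sum_j `|A i j|.
have entry i j : cvgn (series (fun p : nat => ((p`!%:R : R)^-1 *: A ^+ p) i j)).
  apply: normed_cvg; apply: series_le_cvg (is_cvg_series_exp_coeff c) => p //=.
    by rewrite /exp_coeff /= divr_ge0 ?exprn_ge0 //;
       do 2 (apply: sumr_ge0 => ? _).
  rewrite mxE normrM ger0_norm ?invr_ge0 // mulrC /exp_coeff /=.
  by rewrite ler_wpM2r ?invr_ge0 // normr_mx_exp_entry.
apply/cvg_ex; exists (\matrix_(i, j)
  limn (series (fun p : nat => ((p`!%:R : R)^-1 *: A ^+ p) i j))).
apply/cvg_mxP => i j; rewrite mxE.
by under eq_fun do rewrite series_mxE; exact: entry.
Qed.

Lemma cvg_mulmxl (R : realType) (m n q : nat) (X : 'M[R]_(m, n))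
    (u : nat -> 'M[R]_(n, q)) (M : 'M[R]_(n, q)) :
  u @ \oo --> M -> (fun p => X *m u p) @ \oo --> X *m M.
Proof.
move=> /cvg_mxP uM; apply/cvg_mxP => i j.
rewrite mxE; under eq_fun do rewrite mxE.
by apply: cvg_big => [|l _]; [exact: add_continuous | exact: cvgM (cvg_cst _) (uM l j)].
Qed.

Lemma cvg_mulmxr (R : realType) (m n q : nat) (X : 'M[R]_(n, q))
    (u : nat -> 'M[R]_(m, n)) (M : 'M[R]_(m, n)) :
  u @ \oo --> M -> (fun p => u p *m X) @ \oo --> M *m X.
Proof.
move=> /cvg_mxP uM; apply/cvg_mxP => i j.
rewrite mxE; under eq_fun do rewrite mxE.
by apply: cvg_big => [|l _]; [exact: add_continuous | exact: cvgM (uM i l) (cvg_cst _)].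
Qed.

(** The relation passes to powers by induction, to partial sums by linearity and
    to limits by continuity of the product with X.  As X may be rectangular,
    taking A = X Y^T and B = Y^T X trades a large exponential for a small one. *)
Lemma expmx_intertwine (R : realType) (m n : nat) (A : 'M[R]_m) (B : 'M[R]_n)
    (X : 'M[R]_(m, n)) :
  A *m X = X *m B -> expmx A *m X = X *m expmx B.
Proof.
move=> AX.
have powAX p : A ^+ p *m X = X *m B ^+ p.
  elim: p => [|p IHp]; first by rewrite !expr0 mul1mx mulmx1.
  by rewrite [A ^+ _]exprS [B ^+ _]exprS -mulmxA IHp mulmxA AX -mulmxA.
have seriesAX p : series (fun l : nat => (l`!%:R : R)^-1 *: A ^+ l) p *m X =
    X *m series (fun l : nat => (l`!%:R : R)^-1 *: B ^+ l) p.
  rewrite !seriesEnat /= mulmx_suml mulmx_sumr; apply: eq_bigr => l _.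
  by rewrite -scalemxAl powAX scalemxAr.
have limAX := cvg_mulmxr _ _ _ _ X _ _ (is_cvg_expmx R m A).
have limXB := cvg_mulmxl _ _ _ _ X _ _ (is_cvg_expmx R n B).
rewrite -(funext seriesAX) in limXB.
exact: (cvg_unique (@norm_hausdorff _ _) limAX limXB).
Qed.

(** * Algebra of the symplectic inverse *)

Lemma trmx_Jmx (R : realType) m : (Jmx R m)^T = - Jmx R m.
Proof.
by rewrite /Jmx tr_block_mx opp_block_mx linearN /= trmx1 !trmx0 oppr0 opprK.
Qed.

Lemma mul_JmxJmx (R : realType) m : Jmx R m *m Jmx R m = - 1%:M.
Proof.
rewrite /Jmx mulmx_block !mulmx0 !mul0mx mulmxN mulNmx !mulmx1 !addr0 !add0r.
by rewrite scalar_mx_block opp_block_mx !oppr0.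
Qed.

Lemma mulmxJJ (R : realType) p m (B : 'M[R]_(p, m + m)) :
  B *m Jmx R m *m Jmx R m = - B.
Proof. by rewrite -mulmxA mul_JmxJmx mulmxN mulmx1. Qed.

Lemma sympl_inv_mul (R : realType) (a b c : nat) (A : 'M[R]_(a + a, b + b))
    (B : 'M[R]_(b + b, c + c)) :
  sympl_inv (A *m B) = sympl_inv B *m sympl_inv A.
Proof.
rewrite /sympl_inv trmx_mul !trmx_Jmx !(mulmxN, mulNmx, mulmxA) mulmxJJ.
by rewrite !mulNmx opprK.
Qed.

Lemma sympl_invK (R : realType) (a b : nat) (A : 'M[R]_(a + a, b + b)) :
  sympl_inv (sympl_inv A) = A.
Proof.
rewrite /sympl_inv !trmx_mul !trmxK !trmx_Jmx !(mulNmx, mulmxN) opprK !mulmxA.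
by rewrite mulmxJJ mul_JmxJmx !mulNmx mul1mx opprK.
Qed.

Lemma sympl_invD (R : realType) (a b : nat) (A B : 'M[R]_(a + a, b + b)) :
  sympl_inv (A + B) = sympl_inv A + sympl_inv B.
Proof. by rewrite /sympl_inv linearD /= mulmxDr mulmxDl. Qed.

Lemma sympl_invZ (R : realType) (a b : nat) (c : R) (A : 'M[R]_(a + a, b + b)) :
  sympl_inv (c *: A) = c *: sympl_inv A.
Proof. by rewrite /sympl_inv linearZ /= -scalemxAr -scalemxAl. Qed.

Lemma sympl_invN (R : realType) (a b : nat) (A : 'M[R]_(a + a, b + b)) :
  sympl_inv (- A) = - sympl_inv A.
Proof. by rewrite -scaleN1r sympl_invZ scaleN1r. Qed.

Lemma sympl_inv1 (R : realType) (a : nat) :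
  sympl_inv (1%:M : 'M[R]_(a + a)) = 1%:M.
Proof. by rewrite /sympl_inv trmx1 mulmx1 trmx_Jmx mulNmx mul_JmxJmx opprK. Qed.

(** * Low-rank factorization of the horizontal lift *)

(** In terms of D = J Delta G J all occurrences of J other than those inside
    symplectic inverses cancel, because U^T J = J U^+ and G Delta^T = - D^+. *)
Lemma Omega_bar_tr (R : realType) (n k : nat) (U Delta : 'M[R]_(n + n, k + k)) :
  let G := invmx (U^T *m U) in
  let D := Jmx R n *m Delta *m G *m Jmx R k in
  (Omega_bar U Delta)^T =
    D *m sympl_inv U - U *m sympl_inv D - U *m (G *m U^T *m D) *m sympl_inv U.
Proof.
move=> G D; have GT : G^T = G by rewrite trmx_inv trmx_mul trmxK.
set K := (Jmx R n)^T *m U *m G *m U^T *m Jmx R n.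
have KT : K^T = K by rewrite /K !trmx_mul !trmxK GT !mulmxA.
rewrite /Omega_bar -/G -/K [LHS]linearD /= !trmx_mul linearB /= trmx1 KT.
rewrite /K /D /sympl_inv !trmx_mul !trmxK GT !trmx_Jmx.
rewrite !(mulmxDl, mulmxDr) !(mulmxN, mulNmx, opprK, mulmxA) ?mulmx1.
by rewrite !mulmxJJ mul_JmxJmx !(mulNmx, mul1mx, mulmxJJ, opprK) addrCA addrA.
Qed.

(** With W = U^+ Delta one has U^T J Delta = J W, so the matrix is Q W Q for
    Q = G J.  Both Q and W are Hamiltonian, and so is an odd palindromic product
    of Hamiltonian matrices. *)
Lemma twisted_quadratic_sp (R : realType) (n k : nat)
    (U Delta : 'M[R]_(n + n, k + k)) (G : 'M[R]_(k + k)) :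
  G^T = G -> sp (sympl_inv U *m Delta) ->
  sp (G *m U^T *m (Jmx R n *m Delta *m G *m Jmx R k)).
Proof.
rewrite /sp /= => GT; set W := sympl_inv U *m Delta => spW.
have WE : U^T *m Jmx R n *m Delta = Jmx R k *m W.
  by rewrite /W /sympl_inv trmx_Jmx !(mulNmx, mulmxN, mulmxA) mul_JmxJmx
    !(mulNmx, mul1mx) opprK.
have -> : G *m U^T *m (Jmx R n *m Delta *m G *m Jmx R k) =
    G *m Jmx R k *m W *m (G *m Jmx R k).
  by rewrite !mulmxA -!(mulmxA G) WE !mulmxA.
have GJ : sympl_inv (G *m Jmx R k) = - (G *m Jmx R k).
  rewrite /sympl_inv trmx_mul GT trmx_Jmx !(mulNmx, mulmxN, mulmxA).
  by rewrite mul_JmxJmx !mulNmx mul1mx opprK.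
clearbody W; move: (G *m Jmx R k) GJ => Q QJ.
by rewrite !sympl_inv_mul QJ spW !(mulNmx, mulmxN, opprK) !mulmxA.
Qed.

(** U A is the part of E along U and H = (I - U U^+) D the part annihilated by
    U^+.  P halves the former and fixes the latter.  Since A is Hamiltonian, the
    two halves of U A U^+ add up while the H-terms give
    H U^+ - U H^+; the terms U U^+ D U^+ and U D^+ U U^+ then cancel against
    those of U A U^+. *)
Lemma sp_lift_rank_factorization (R : realType) (n k : nat)
    (U D : 'M[R]_(n + n, k + k)) (S : 'M[R]_(k + k)) :
  SpSt U -> sp S ->
  let A := sympl_inv U *m D - sympl_inv D *m U - S in
  let E := U *m A + (1%:M - U *m sympl_inv U) *m D in
  let P := 1%:M - 2^-1 *: (U *m sympl_inv U) in
  P *m E *m sympl_inv U - U *m (sympl_inv E *m P) =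
  D *m sympl_inv U - U *m sympl_inv D - U *m S *m sympl_inv U.
Proof.
move=> UU spS A E P.
have {}UU : sympl_inv U *m U = 1%:M := UU.
have {}spS : sympl_inv S = - S := spS.
pose H := (1%:M - U *m sympl_inv U) *m D.
have EE : E = U *m A + H by [].
have AE : A = sympl_inv U *m D - sympl_inv D *m U - S by [].
have HE : H = D - U *m sympl_inv U *m D by rewrite /H mulmxBl mul1mx.
(* Abstract atoms keep rewriting from matching through their bodies. *)
clearbody H E A.
have spA : sympl_inv A = - A.
  rewrite AE !sympl_invD !sympl_invN !(sympl_invK, sympl_inv_mul) spS.
  by rewrite !opprD !opprK [- _ + _]addrC.
have UH : sympl_inv U *m H = 0 by rewrite HE mulmxBr !mulmxA UU mul1mx subrr.
have spP : sympl_inv P = P.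
  by rewrite /P sympl_invD sympl_invN sympl_invZ !(sympl_invK, sympl_inv_mul)
    sympl_inv1.
have PE : P *m E = 2^-1 *: (U *m A) + H.
  rewrite /P EE mulmxBl mul1mx -scalemxAl -mulmxA mulmxDr UH addr0.
  rewrite [sympl_inv U *m (U *m A)]mulmxA UU mul1mx.
  rewrite addrAC -[X in X - _]scale1r -scalerBl; congr (_ *: _ + _).
  by field.
have EP : sympl_inv E *m P = - (2^-1 *: (A *m sympl_inv U)) + sympl_inv H.
  rewrite -[X in _ *m X]spP -sympl_inv_mul PE sympl_invD sympl_invZ.
  by rewrite sympl_inv_mul spA mulNmx scalerN.
have halves : 2^-1 *: (U *m A *m sympl_inv U) +
    2^-1 *: (U *m A *m sympl_inv U) = U *m A *m sympl_inv U.
  by rewrite -scalerDl -[RHS]scale1r; congr (_ *: _); field.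
rewrite PE EP mulmxDl mulmxDr mulmxN -scalemxAl -scalemxAr.
rewrite [U *m (A *m _)]mulmxA opprD opprK addrACA halves.
rewrite AE HE sympl_invD sympl_invN !(sympl_invK, sympl_inv_mul).
move: (sympl_inv U) (sympl_inv D) => V D'.
rewrite !(mulmxBl, mulmxBr, mulmxA).
move: (U *m V *m D *m V) (U *m D' *m U *m V) => x y.
move: (D *m V) (U *m D') (U *m S *m V) => a b c.
by apply/matrixP => i j; rewrite !mxE; ring.
Qed.

(** * The small-exponential formula *)

Theorem proposition3p13 (R : realType) (n k : nat) (k_gt0 : (0 < k)%N)
    (k_le_n : (k <= n)%N) (U Delta : 'M[R]_(n + n, k + k))
    (U_SpSt : SpSt U) (Delta_tangent : tangent_SpSt U Delta) :
  let Jn := Jmx R n in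
  let Jk := Jmx R k in
  let G := invmx (U^T *m U) in
  let Abar : 'M[R]_(k + k) :=
    Jk *m U^T *m Delta *m G *m Jk + G *m Delta^T *m U
    - G *m Delta^T *m Jn^T *m U *m G *m Jk in
  let Hbar : 'M[R]_(n + n, k + k) :=
    (1%:M - U *m sympl_inv U) *m Jn *m Delta *m G *m Jk in
  let Deltabar : 'M[R]_(n + n, k + k) := U *m Abar + Hbar in
  let P : 'M[R]_(n + n) := 1%:M - 2^-1 *: (U *m sympl_inv U) in
  let X : 'M[R]_(n + n, (k + k) + (k + k)) := row_mx (P *m Deltabar) (- U) in
  let Y : 'M[R]_(n + n, (k + k) + (k + k)) :=
    row_mx (Jn^T *m U *m Jk) (sympl_inv Deltabar *m P)^T in
  let Xhat : 'M[R]_(n + n, ((k + k) + (k + k)) + ((k + k) + (k + k))) :=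
    row_mx Y (- X) in
  let Yhat : 'M[R]_(n + n, ((k + k) + (k + k)) + ((k + k) + (k + k))) :=
    row_mx X Y in
  Exp_SpSt U Delta =
    Xhat *m expmx (Yhat^T *m Xhat)
    *m (col_mx 0 1%:M : 'M[R]_(((k + k) + (k + k)) + ((k + k) + (k + k)),
                               (k + k) + (k + k)))
    *m expmx (Y^T *m X)
    *m (col_mx 0 1%:M : 'M[R]_((k + k) + (k + k), k + k)).
Proof.
move=> Jn Jk G Abar Hbar Deltabar P X Y Xhat Yhat.
have GT : G^T = G by rewrite trmx_inv trmx_mul trmxK.
pose D := Jn *m Delta *m G *m Jk.
pose S := G *m U^T *m D.
have spS : sp S := twisted_quadratic_sp R n k U Delta G GT Delta_tangent.
have spSE : sympl_inv S = - S := spS.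
have GDelta : G *m Delta^T = - sympl_inv D.
  rewrite /D /sympl_inv !trmx_mul GT !trmx_Jmx !(mulNmx, mulmxN, mulmxA).
  by rewrite mul_JmxJmx mulmxJJ !(mulNmx, mul1mx) !opprK.
have HbarE : Hbar = (1%:M - U *m sympl_inv U) *m D by rewrite /Hbar /D !mulmxA.
have AbarE : Abar = sympl_inv U *m D - sympl_inv D *m U - S.
  rewrite /Abar GDelta -[in RHS]spSE; congr (_ + _ + _).
  - rewrite /D /sympl_inv trmx_Jmx !(mulNmx, mulmxN, mulmxA) mulmxJJ.
    by rewrite !(mulNmx, opprK).
  - by rewrite mulNmx.
  - (* S is Hamiltonian, so the last term - S of the right side is S^+. *)
    rewrite /S (sympl_inv_mul _ _ _ _ (G *m U^T) D).
    rewrite [sympl_inv (G *m U^T)]/sympl_inv trmx_mul trmxK GT.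
    by rewrite !(mulNmx, opprK) !mulmxA.
have YU : (Jn^T *m U *m Jk)^T = sympl_inv U.
  by rewrite /sympl_inv !trmx_mul trmxK !mulmxA.
have XY : (Omega_bar U Delta)^T = X *m Y^T.
  rewrite Omega_bar_tr -/D -/S.
  rewrite -(sp_lift_rank_factorization _ _ _ _ _ _ U_SpSt spS).
  by rewrite /X /Y tr_row_mx mul_row_col YU trmxK mulNmx -HbarE -AbarE.
have XhatYhat : Omega_bar U Delta - (Omega_bar U Delta)^T = Xhat *m Yhat^T.
  rewrite -{1}(trmxK (Omega_bar U Delta)) XY trmx_mul !trmxK.
  by rewrite /Xhat /Yhat tr_row_mx mul_row_col mulNmx.
(* U and X are, up to sign, the last blocks of X and Xhat; the two signs cancel
   in the end. *)
have UE : U = - (X *m col_mx 0 1%:M).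
  by rewrite /X mul_row_col mulmx0 mulmx1 add0r opprK.
have XE : X = - (Xhat *m col_mx 0 1%:M).
  by rewrite /Xhat mul_row_col mulmx0 mulmx1 add0r opprK.
rewrite /Exp_SpSt XhatYhat XY [in LHS]UE mulmxN mulmxA.
have XcommE : expmx (X *m Y^T) *m X = X *m expmx (Y^T *m X).
  by apply: expmx_intertwine; rewrite mulmxA.
have XhatcommE :
    expmx (Xhat *m Yhat^T) *m Xhat = Xhat *m expmx (Yhat^T *m Xhat).
  by apply: expmx_intertwine; rewrite mulmxA.
rewrite -(mulmxA (expmx (Xhat *m Yhat^T))) XcommE [X in _ *m (X *m _)]XE.
by rewrite !(mulNmx, mulmxN) opprK !mulmxA XhatcommE.
Qed.
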